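(* Let $m,n\in\mathbb{N}$ with $m\geq 1$, and let $f:\mathbb{R}^m\to\mathbb{R}$ be a given function. Then there exists an algorithm with runtime complexity $O\big(N(m,n)^2\big)$, requiring storage $O\big(mN(m,n)\big)$, that computes a generic set $P\subseteq\mathbb{R}^m$ (with respect to $m,n$) and a polynomial $Q\in\mathbb{R}[x_1,\dots,x_m]$ with $\deg(Q)\leq n$ such that $Q$ is the unique solution of the polynomial interpolation problem with respect to $P$ and $f$; that is, $Q$ is the unique polynomial in $\mathbb{R}[x_1,\dots,x_m]$ of degree at most $n$ with $Q(p)=f(p)$ for all $p\in P$.
   Context: Here $0\in\mathbb{N}$ and $N(m,n):=\binom{m+n}{m}$, the number of monomials of degree at most $n$ in $m$ variables. A set $P=\{p_1,\dots,p_{N(m,n)}\}\subseteq\mathbb{R}^m$ of $N(m,n)$ nodes is called generic with respect to $m,n$ if the multivariate Vandermonde matrix $V_{m,n}(P)\in\mathbb{R}^{N(m,n)\times N(m,n)}$, whose $i$-th row consists of the values at $p_i$ of all monomials $x_1^{i_1}\cdots x_m^{i_m}$ with $i_1+\dots+i_m\leq n$ (in a fixed order), is regular (invertible). A polynomial is computed by computing its coefficients. Complexity is measured in the model where the value $f(x)$ at any $x\in\mathbb{R}^m$ can be evaluated in $O(1)$ time and each (real/floating-point) arithmetic operation takes $O(1)$ time; storage counts the number of stored numbers. The $O$-bounds have absolute constants, independent of $m$, $n$ and $f$. *)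

(* Defs.v *)
From HB Require Import structures.
From mathcomp Require Import all_boot all_order all_algebra.
From mathcomp Require Import reals.
From mathcomp Require Import mpoly.

Set Implicit Arguments.
Unset Strict Implicit.
Unset Printing Implicit Defensive.

Import Order.TTheory GRing.Theory Num.Theory.

Definition N (m n : nat) : nat := 'C(m + n, m).

(* Exponent vectors of the monomials of degree at most n in m variables, in
   increasing lexicographic order; this is the order fixed both for the columns
   of the Vandermonde matrix and for listing the coefficients of a polynomial. *)
Fixpoint exponents (m n : nat) : seq (seq nat) :=
  if m is m'.+1 then
    flatten [seq [seq k :: e | e <- exponents m' (n - k)] | k <- iota 0 n.+1]
  else [:: [::]].

Definition monom (m n : nat) (j : nat) : 'X_{1..m} :=
  [multinom nth 0 (nth [::] (exponents m n) j) k | k < m].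

Lemma exponentsS m n : exponents m.+1 n =
  flatten [seq [seq k :: e | e <- exponents m (n - k)] | k <- iota 0 n.+1].
Proof. by []. Qed.

Lemma mem_exponents m n (e : seq nat) :
  (e \in exponents m n) = (size e == m) && (sumn e <= n).
Proof.
elim: m n e => [|m IH] n e; first by rewrite inE; case: e.
rewrite exponentsS; apply/flatten_mapP/idP => [[k]|].
  rewrite -[_ \in _]/(k \in iota 0 n.+1) mem_iota add0n ltnS => /= kn.
  case/mapP=> e'; rewrite IH => /andP[s1 s2] ->.
  by rewrite /= eqSS s1 -leq_subRL.
case: e => // k e /=; rewrite eqSS => /andP[s1 s2].
have kn : k <= n by apply: leq_trans s2; apply: leq_addr.
exists k; first by rewrite -[_ \in _]/(k \in iota 0 n.+1) mem_iota add0n ltnS.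
by apply/mapP; exists e => //; rewrite IH s1 leq_subRL.
Qed.

Lemma uniq_exponents m n : uniq (exponents m n).
Proof.
elim: m n => [|m IH] n; first by [].
rewrite exponentsS; apply: allpairs_uniq_dep (iota_uniq _ _) _ _ => [k _|].
  exact: IH.
by move=> [k e] [k' e'] /= _ _ [-> ->].
Qed.

Lemma size_exponents m n : size (exponents m n) = N m n.
Proof.
elim: m n => [|m IH] n; first by rewrite /N bin0.
rewrite exponentsS size_flatten /shape -map_comp.
rewrite (eq_map (_ : _ =1 fun k => N m (n - k))); last first.
  by move=> k /=; rewrite size_map IH.
elim: n {IH} => [|n IHn]; first by rewrite /= /N !addn0 !binn.
rewrite -[iota 0 n.+2]/(0 :: iota (1 + 0) n.+1) iotaDl map_cons -map_comp.
rewrite (eq_map (_ : _ =1 fun k => N m (n - k))); last first.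
  by move=> k; rewrite /= add1n subSS.
rewrite -[sumn _]/(N m (n.+1 - 0) + sumn [seq N m (n - k) | k <- iota 0 n.+1]).
by rewrite subn0 IHn /N addSnnS [in RHS]addSn [in RHS]binS addnC.
Qed.

Lemma mdeg_monom m n (j : 'I_(N m n)) : mdeg (monom m n j) <= n.
Proof.
have: nth [::] (exponents m n) j \in exponents m n.
  by apply: mem_nth; rewrite size_exponents.
rewrite mem_exponents => /andP[/eqP se]; apply: leq_trans.
rewrite mdegE sumnE (big_nth 0) se big_mkord leq_eqVlt; apply/orP; left; apply/eqP.
by apply: eq_bigr => k _; rewrite mnmE.
Qed.

Lemma monom_inj m n : injective (fun j : 'I_(N m n) => monom m n j).
Proof.
move=> i j /mnmP eij; apply/val_inj/eqP.
rewrite -(nth_uniq [::] _ _ (uniq_exponents m n)) ?size_exponents ?ltn_ord //.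
have s (l : 'I_(N m n)) : size (nth [::] (exponents m n) l) = m.
  have: nth [::] (exponents m n) l \in exponents m n.
    by apply: mem_nth; rewrite size_exponents.
  by rewrite mem_exponents => /andP[/eqP].
apply/eqP/(@eq_from_nth _ 0); first by rewrite !s.
by move=> k; rewrite s => km; have := eij (Ordinal km); rewrite !mnmE.
Qed.

Lemma monom_surj m n (e : 'X_{1..m}) :
  mdeg e <= n -> exists j : 'I_(N m n), monom m n j = e.
Proof.
move=> en; have ein : (e : seq nat) \in exponents m n.
  rewrite mem_exponents size_tuple eqxx sumnE big_tuple; apply: leq_trans en.
  by rewrite mdegE; apply/eq_leq/eq_bigr => k _.
have := ein; rewrite -index_mem size_exponents => lt.
exists (Ordinal lt); apply/mnmP => k.
by rewrite mnmE /= nth_index // (mnm_nth 0).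
Qed.

(* Row i of P is the node p_i. *)
Definition vandermonde (R : realType) (m n : nat) (P : 'M[R]_(N m n, m))
    : 'M[R]_(N m n) :=
  (\matrix_(i, j) \prod_(k < m) P i k ^+ monom m n j k)%R.

Definition generic (R : realType) (m n : nat) (P : 'M[R]_(N m n, m)) : Prop :=
  vandermonde P \in unitmx.

Definition interpolates (R : realType) (m n : nat) (f : 'rV[R]_m -> R)
    (P : 'M[R]_(N m n, m)) (Q : {mpoly R[m]}) : Prop :=
  forall i, Q.@[P i] = f (row i P).

(* Algorithms are programs of a real RAM: an integer memory (for indices and
   loop counters) and a real memory, both indirectly addressable, with one
   oracle instruction that evaluates f at a point stored in m consecutive real
   cells.  The syntax mentions neither m, n, f nor any real constant, so that a
   program is a finite object that is uniform in all the data. *)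
Inductive iexp : Type :=
| ILit of nat
| IGet of iexp
| IAdd of iexp & iexp
| ISub of iexp & iexp.

Inductive rexp : Type :=
| RNat of iexp
| RGet of iexp
| RAdd of rexp & rexp
| RSub of rexp & rexp
| RMul of rexp & rexp
| RDiv of rexp & rexp.

Inductive bexp : Type :=
| BLeI of iexp & iexp
| BLeR of rexp & rexp.

Inductive cmd : Type :=
| Skip
| ISet of iexp & iexp      (* destination address, value *)
| RSet of iexp & rexp      (* destination address, value *)
| Call of iexp & iexp      (* destination address, address of the argument *)
| Seq of cmd & cmd
| If of bexp & cmd & cmd
| While of bexp & cmd.

(* Evaluating an expression costs one unit per operation in it. *)
Fixpoint icost (e : iexp) : nat :=
  match e with
  | ILit _ => 1
  | IGet a => (icost a).+1
  | IAdd a b | ISub a b => (icost a + icost b).+1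
  end.

Fixpoint rcost (e : rexp) : nat :=
  match e with
  | RNat a | RGet a => (icost a).+1
  | RAdd a b | RSub a b | RMul a b | RDiv a b => (rcost a + rcost b).+1
  end.

Definition bcost (b : bexp) : nat :=
  match b with
  | BLeI x y => (icost x + icost y).+1
  | BLeR x y => (rcost x + rcost y).+1
  end.

Record state (R : Type) : Type := State { imem : nat -> nat; rmem : nat -> R }.

Definition upd (T : Type) (h : nat -> T) (a : nat) (x : T) : nat -> T :=
  fun b => if b == a then x else h b.

Definition lift2 (A B : Type) (op : A -> A -> option B) (x y : option A)
    : option B :=
  obind (fun x => obind (op x) y) x.

Section Semantics.
Variables (R : realType) (m : nat) (f : 'rV[R]_m -> R).
(* The capacity: each memory consists of the cells 0, ..., cap - 1 only. *)
Variable cap : nat.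
Local Open Scope ring_scope.

Definition fetch (T : Type) (h : nat -> T) (a : nat) : option T :=
  if (a < cap)%N then Some (h a) else None.

(* None is a run-time error: an address out of bounds, or a division by 0. *)
Fixpoint ieval (s : state R) (e : iexp) : option nat :=
  match e with
  | ILit k => Some k
  | IGet a => obind (fetch (imem s)) (ieval s a)
  | IAdd a b => lift2 (fun x y => Some (x + y)%N) (ieval s a) (ieval s b)
  | ISub a b => lift2 (fun x y => Some (x - y)%N) (ieval s a) (ieval s b)
  end.

Fixpoint reval (s : state R) (e : rexp) : option R :=
  match e with
  | RNat a => omap (fun k => k%:R) (ieval s a)
  | RGet a => obind (fetch (rmem s)) (ieval s a)
  | RAdd a b => lift2 (fun x y => Some (x + y)) (reval s a) (reval s b)
  | RSub a b => lift2 (fun x y => Some (x - y)) (reval s a) (reval s b)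
  | RMul a b => lift2 (fun x y => Some (x * y)) (reval s a) (reval s b)
  | RDiv a b => lift2 (fun x y => if y == 0 then None else Some (x / y))
                      (reval s a) (reval s b)
  end.

Definition beval (s : state R) (b : bexp) : option bool :=
  match b with
  | BLeI x y => lift2 (fun x y => Some (x <= y)%N) (ieval s x) (ieval s y)
  | BLeR x y => lift2 (fun x y => Some (x <= y)) (reval s x) (reval s y)
  end.

(* exec c s t s': started in s, c halts without run-time error in s', after t
   time units. *)
Inductive exec : cmd -> state R -> nat -> state R -> Prop :=
| ExecSkip s : exec Skip s 1 s
| ExecISet d e s a x :
    ieval s d = Some a -> (a < cap)%N -> ieval s e = Some x ->
    exec (ISet d e) s (icost d + icost e).+1
         (State (upd (imem s) a x) (rmem s))
| ExecRSet d e s a x :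
    ieval s d = Some a -> (a < cap)%N -> reval s e = Some x ->
    exec (RSet d e) s (icost d + rcost e).+1
         (State (imem s) (upd (rmem s) a x))
| ExecCall d e s a b :
    ieval s d = Some a -> (a < cap)%N -> ieval s e = Some b -> (b + m <= cap)%N ->
    exec (Call d e) s (icost d + icost e).+1
         (State (imem s)
                (upd (rmem s) a (f (\row_(k < m) rmem s (b + k)%N))))
| ExecSeq c1 c2 s1 s2 s3 t1 t2 :
    exec c1 s1 t1 s2 -> exec c2 s2 t2 s3 ->
    exec (Seq c1 c2) s1 (t1 + t2).+1 s3
| ExecIf b c1 c2 s s' v t :
    beval s b = Some v -> exec (if v then c1 else c2) s t s' ->
    exec (If b c1 c2) s (bcost b + t).+1 s'
| ExecWhileStop b c s :
    beval s b = Some false ->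
    exec (While b c) s (bcost b).+1 s
| ExecWhileStep b c s1 s2 s3 t1 t2 :
    beval s1 b = Some true -> exec c s1 t1 s2 -> exec (While b c) s2 t2 s3 ->
    exec (While b c) s1 (bcost b + t1 + t2).+1 s3.

Lemma exec_det c s t1 s1 t2 s2 :
  exec c s t1 s1 -> exec c s t2 s2 -> t1 = t2 /\ s1 = s2.
Proof.
move=> H; elim: H t2 s2 => {c s t1 s1}.
- by move=> s t2 s2 H; inversion H.
- move=> d e s a x Ha _ Hx t2 s2 H; inversion H; subst.
  by split => //; congr (State (upd _ _ _) _); congruence.
- move=> d e s a x Ha _ Hx t2 s2 H; inversion H; subst.
  by split => //; congr (State _ (upd _ _ _)); congruence.
- move=> d e s a b Ha _ Hb _ t2 s2 H; inversion H; subst.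
  have -> : a = a0 by congruence.
  by have -> : b = b0 by congruence.
- move=> c1 c2 s1 s2 s3 t1 t2 _ IH1 _ IH2 t s H; inversion H; subst.
  match goal with h : exec c1 _ _ _ |- _ => case: (IH1 _ _ h) => * end; subst.
  by match goal with h : exec c2 _ _ _ |- _ => case: (IH2 _ _ h) => * end; subst.
- move=> b c1 c2 s s' v t Hb _ IH t2 s2 H; inversion H; subst.
  match goal with h : beval s b = Some ?w |- _ =>
    have Ev : w = v by congruence end.
  match goal with h : exec (if _ then _ else _) _ _ _ |- _ =>
    rewrite Ev in h; by case: (IH _ _ h) => *; subst end.
- by move=> b c s Hb t2 s2 H; inversion H; subst => //; congruence.
- move=> b c s1 s2 s3 t1 t2 Hb _ IH1 _ IH2 t s H; inversion H; subst.
    by congruence.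
  match goal with h : exec c _ _ _ |- _ => case: (IH1 _ _ h) => * end; subst.
  by match goal with h : exec (While _ _) _ _ s |- _ =>
    case: (IH2 _ _ h) => * end; subst.
Qed.

End Semantics.

(* Input convention: m and n in the integer cells 0 and 1; all other cells
   are 0. *)
Definition init (R : realType) (m n : nat) : state R :=
  State (nth 0 [:: m; n]) (fun _ => 0%R).

(* Output convention: the integer cells 0 and 1 hold the addresses of two
   blocks of real cells, inside the capacity cap; the first block lists the
   coordinates of the N(m,n) nodes, node after node, the second one the N(m,n)
   coefficients. *)
Definition output_fits (R : realType) (m n cap : nat) (s : state R) : Prop :=
  imem s 0 + N m n * m <= cap /\ imem s 1 + N m n <= cap.

Definition output_nodes (R : realType) (m n : nat) (s : state R)
    : 'M[R]_(N m n, m) :=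
  (\matrix_(i, k) rmem s (imem s 0 + i * m + k)%N)%R.

Definition output_poly (R : realType) (m n : nat) (s : state R)
    : {mpoly R[m]} :=
  (\sum_(j < N m n) rmem s (imem s 1 + j)%N *: 'X_[monom m n j])%R.

(* Main.v *)
(* Take the nodes p_i = (q_0^i, ..., q_(m-1)^i) for i < N = N(m,n), where
   q_k = 2^((n+1)^k).  The monomial x^e takes the value (x_e)^i at p_i, where
   x_e = 2^(sum_k e_k (n+1)^k), and the x_e are pairwise distinct because e is
   read off from the digits of its exponent in base n+1.  Hence the multivariate
   Vandermonde matrix is the transpose of a univariate one: it is invertible, and
   the system sum_e c_e x_e^i = f(p_i) is solved in time O(N^2) and space O(N).
   Indeed let M = prod_e (X - x_e), and let b_0, ..., b_(N-1) be the coefficients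
   of M / (X - x_e), which synthetic division produces one after the other; then
   c_e = (sum_i b_i f(p_i)) / (sum_i b_i x_e^i).
   The x_e are enumerated in lexicographic order by extending exponent vectors one
   coordinate at a time.  The bounds use m n < N, which holds for all m, n; for
   n = 0 there is no time to write the m coordinates of a node, and the node 0,
   already present in the memory, is used instead. *)

Require Import Defs.
From mathcomp Require Import all_boot all_order all_algebra.
From mathcomp Require Import reals.
From mathcomp Require Import mpoly.
From mathcomp Require Import zify.

Set Implicit Arguments.
Unset Strict Implicit.
Unset Printing Implicit Defensive.

Import Order.TTheory GRing.Theory Num.Theory.

(** * The interpolation system *)

Lemma N_gt0 m n : 0 < N m n.
Proof. by rewrite bin_gt0 leq_addr. Qed.

Lemma NS m n : N m.+1 n.+1 = N m n.+1 + N m.+1 n.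
Proof. by rewrite /N addSn binS addnC -addSnnS. Qed.

(** Double induction along Pascal's rule; strictness of both summands pays for the extra 1 in
    [m.+1 * n.+1]. *)
Lemma ltn_mul_N m n : m * n < N m n.
Proof.
elim: m n => [|m IHm] n; first by rewrite mul0n N_gt0.
elim: n => [|n IHn]; first by rewrite muln0 N_gt0.
by rewrite NS; have := IHm n.+1; lia.
Qed.

Lemma leq_N m1 m2 n : m1 <= m2 -> N m1 n <= N m2 n.
Proof.
case: n => [|n]; first by rewrite /N !addn0 !binn.
elim: m2 => [|m2 IH]; first by rewrite leqn0 => /eqP ->.
rewrite leq_eqVlt ltnS => /orP[/eqP -> //|/IH le].
by apply: leq_trans le _; rewrite NS leq_addr.
Qed.

Lemma mul_addr_lt m i j k : i < j -> k < m -> i * m + k < j * m.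
Proof.
move=> ij km; apply: leq_trans (_ : i.+1 * m <= _); last by rewrite leq_mul2r ij orbT.
by rewrite mulSn; lia.
Qed.

Lemma flatten_map_flatten (T U : Type) (g : T -> seq U) (ss : seq (seq T)) :
  flatten [seq g x | x <- flatten ss] =
  flatten [seq flatten [seq g x | x <- s] | s <- ss].
Proof. by elim: ss => //= s ss IHss; rewrite map_cat flatten_cat IHss. Qed.

#[local] Arguments exponents : simpl never.

(** [exponents] prepends coordinates while the program appends them; both constructions give the
    same lexicographic list. *)
Lemma exponents_rcons m n : exponents m.+1 n =
  flatten [seq [seq rcons e i | i <- iota 0 (n - sumn e).+1] | e <- exponents m n].
Proof.
elim: m n => [|m IHm] n.
  by rewrite exponentsS -[RHS]/(_ ++ [::]) cats0 subn0;
    elim: (iota 0 n.+1) => //= a l ->.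
rewrite exponentsS [in RHS]exponentsS flatten_map_flatten -!map_comp.
congr flatten; apply: eq_map => k /=.
rewrite IHm map_flatten -!map_comp; congr flatten; apply: eq_map => e.
by rewrite /comp -map_comp -[sumn (k :: e)]/(k + sumn e)%N subnDA.
Qed.

(** * Exponent vectors as numerals in base n+1 *)

Section Code.
Variable n : nat.

Definition code (e : seq nat) : nat := foldr (fun a w => a + n.+1 * w) 0 e.

Lemma code_rcons e a : code (rcons e a) = code e + n.+1 ^ size e * a.
Proof. by elim: e => [|b e IHe] /=; rewrite ?muln0 ?IHe ?expnS; lia. Qed.

(** A sum at most [n] makes every entry a genuine digit in base [n.+1], so reduction modulo [n.+1]
    recovers the first one. *)
Lemma code_inj e1 e2 : size e1 = size e2 -> sumn e1 <= n -> sumn e2 <= n ->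
  code e1 = code e2 -> e1 = e2.
Proof.
elim: e1 e2 => [|a e1 IHe] [|b e2] //= [eqs] le1 le2 eqc.
have lta : a < n.+1 by lia.
have ltb : b < n.+1 by lia.
have eqab : a = b.
  by have := congr1 (modn^~ n.+1) eqc;
    rewrite ![_ + n.+1 * _]addnC ![n.+1 * _]mulnC !modnMDl !modn_small.
rewrite eqab in eqc *; congr (_ :: _); apply: IHe => //; try lia.
by move/addnI/eqP: eqc; rewrite eqn_pmul2l // => /eqP.
Qed.

Lemma codeE e : code e = \sum_(k < size e) n.+1 ^ k * nth 0 e k.
Proof.
elim: e => [|a e IHe] /=; first by rewrite big_ord0.
rewrite big_ord_recl mul1n IHe big_distrr; congr addn.
by apply: eq_bigr => k _; rewrite /= expnS mulnA.
Qed.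

End Code.

(** * Transposed univariate Vandermonde systems *)

Section Transposed.
Local Open Scope ring_scope.
Variables (F : fieldType) (L : nat) (x y : nat -> F).
Hypothesis x_inj : forall i j, (i < L)%N -> (j < L)%N -> x i = x j -> i = j.

Definition tvander : 'M[F]_L := \matrix_(i, j) x j ^+ i.

Lemma tvander_unit : tvander \in unitmx.
Proof.
have -> : tvander = Vandermonde L (\row_j x j).
  by apply/matrixP => i j; rewrite !mxE.
rewrite unitmxE det_Vandermonde unitfE.
apply/prodf_neq0 => i _; apply/prodf_neq0 => j ij; rewrite !mxE subr_eq0.
by apply/eqP => /x_inj e; rewrite e // ltnn in ij.
Qed.

Definition master (k : nat) : {poly F} := \prod_(j < k) ('X - (x j)%:P).

(** Multiplication by X - x_j, in the shape of the in-place update in [expand_master]. *)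
Lemma masterS j i : (master j.+1)`_i =
  (if i == 0%N then 0 else (master j)`_i.-1) - x j * (master j)`_i.
Proof.
by rewrite /master big_ord_recr /= mulrBr coefB coefMX coefMC [x j * _]mulrC.
Qed.

Definition comaster (j : 'I_L) : {poly F} := \prod_(l < L | l != j) ('X - (x l)%:P).

Lemma masterE (j : 'I_L) : master L = comaster j * ('X - (x j)%:P).
Proof. by rewrite /master (bigD1 j) //= mulrC. Qed.

Lemma size_comaster j : (size (comaster j) <= L)%N.
Proof.
rewrite /comaster -big_filter size_prod_XsubC size_filter.
have lt : (count (fun l => l != j) (index_enum 'I_L) < size (index_enum 'I_L))%N.
  rewrite -(count_predC (fun l => l != j)) -[X in (X < _)%N]addn0 ltn_add2l -has_count.
  by apply/hasP; exists j; rewrite ?mem_index_enum //= negbK.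
by move: lt; rewrite -[index_enum _]enumT size_enum_ord.
Qed.

(** Synthetic division: comparing coefficients in [masterE] yields the quotient from the top
    downwards, the order followed by [solve]. *)
Lemma comasterSr j i : (comaster j)`_i = (master L)`_i.+1 + x j * (comaster j)`_i.+1.
Proof. by rewrite (masterE j) mulrBr coefB coefMX coefMC /= [x j * _]mulrC subrK. Qed.

Lemma comaster_hornerE (j l : 'I_L) :
  (comaster j).[x l] = (comaster j).[x j] *+ (l == j).
Proof.
case: eqP => [-> //|/eqP lj]; rewrite mulr0n.
by rewrite /comaster (bigD1 l) //= hornerM hornerXsubC subrr mul0r.
Qed.

Lemma comaster_neq0 (j : 'I_L) : (comaster j).[x j] != 0.
Proof.
rewrite /comaster horner_prod; apply/prodf_neq0 => l lj.
by rewrite hornerXsubC subr_eq0; apply: contraNneq lj => /x_inj e;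
  apply/eqP/val_inj/esym/e.
Qed.

(** The coefficients of the Lagrange basis polynomial, [comaster j] divided by its value at [x j],
    form row [j] of the inverse of [tvander]. *)
Definition tsol (j : 'I_L) : F :=
  (\sum_(i < L) (comaster j)`_i * y i) / (comaster j).[x j].

Lemma tsolP (i : 'I_L) : \sum_(j < L) x j ^+ i * tsol j = y i.
Proof.
(* A solution [c] exists by invertibility; it remains to see that the formula recovers each of its
   entries. *)
pose c := invmx tvander *m (\col_i y i).
have Vc (l : 'I_L) : y l = \sum_(j < L) x j ^+ l * c j 0.
  have := congr1 (fun A : 'cV_L => A l 0) (mulKVmx tvander_unit (\col_i y i)).
  rewrite !mxE => <-; apply: eq_bigr => j _; by rewrite mxE.
suff Ec j : tsol j = c j 0 by under eq_bigr do rewrite Ec.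
apply: (canLR (mulfK (comaster_neq0 j))).
under eq_bigr do rewrite Vc mulr_sumr.
rewrite exchange_big /= .
(* Weighting equation [i] by coefficient [i] of [comaster j] turns column [l] into the value of
   [comaster j] at [x l], which vanishes unless [l = j]. *)
have E (l : 'I_L) : \sum_(i < L) (comaster j)`_i * (x l ^+ i * c l 0) =
  (comaster j).[x l] * c l 0.
  by rewrite (horner_coef_wide _ (size_comaster j)) mulr_suml;
    apply: eq_bigr => i0 _; rewrite mulrA.
under eq_bigr do rewrite E comaster_hornerE.
rewrite (bigD1 j) //= eqxx mulr1n [X in _ + X]big1 ?addr0 => [|l /negbTE ->];
  first exact: mulrC.
by rewrite mulr0n mul0r.
Qed.

End Transposed.

(** * Coefficient vectors and the choice of nodes *)

Section Interpolation.
Local Open Scope ring_scope.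
Variables (R : realType) (m n : nat).

Definition poly_of (c : nat -> R) : {mpoly R[m]} :=
  \sum_(j < N m n) c j *: 'X_[monom m n j].

Lemma msize_poly_of c : (msize (poly_of c) <= n.+1)%N.
Proof.
apply: leq_trans (msize_sum _ _ _) _; apply/bigmax_leqP => j _.
by apply: leq_trans (msizeZ_le _ _) _; rewrite msizeX ltnS mdeg_monom.
Qed.

Lemma poly_of_eval c (P : 'M[R]_(N m n, m)) i :
  (poly_of c).@[P i] = \sum_j vandermonde P i j * c j.
Proof.
rewrite /poly_of raddf_sum; apply: eq_bigr => j _ /=.
by rewrite mevalZ mevalX mxE mulrC.
Qed.

Lemma coef_poly_of c (j : 'I_(N m n)) : (poly_of c)@_(monom m n j) = c j.
Proof.
rewrite /poly_of raddf_sum /= (bigD1 j) //= mcoeffZ mcoeffX eqxx mulr1 big1 ?addr0 //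
  => l lj.
by rewrite mcoeffZ mcoeffX (inj_eq (@monom_inj m n)) (negbTE lj) mulr0.
Qed.

(** This reduces uniqueness of the interpolant to injectivity of the Vandermonde matrix on
    coefficient vectors. *)
Lemma poly_ofP (Q : {mpoly R[m]}) : (msize Q <= n.+1)%N ->
  exists c, Q = poly_of c.
Proof.
move=> szQ; exists (fun j => Q@_(monom m n j)); apply/mpolyP => e.
have [le|gt] := leqP (mdeg e) n.
  by have [j <-] := monom_surj le; rewrite coef_poly_of.
have out (p : {mpoly R[m]}) : (msize p <= n.+1)%N -> p@_e = 0.
  move=> sz; apply: memN_msupp_eq0; apply: contraL gt => /msize_mdeg_lt lt.
  by rewrite -leqNgt -ltnS; apply: leq_trans lt sz.
by rewrite !out ?msize_poly_of.
Qed.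

Lemma generic_uniq f (P : 'M[R]_(N m n, m)) Q Q' : generic P ->
  (msize Q <= n.+1)%N -> (msize Q' <= n.+1)%N ->
  interpolates f P Q -> interpolates f P Q' -> Q' = Q.
Proof.
move=> gP /poly_ofP[c ->] /poly_ofP[c' ->] ic ic'.
have E : \col_(j < N m n) c' j = \col_(j < N m n) c j.
  apply: (can_inj (mulKmx gP)); apply/matrixP => i k; rewrite !mxE.
  have e (d : nat -> R) : \sum_j vandermonde P i j * (\col_(j < N m n) d j) j k =
    (poly_of d).@[P i].
    by rewrite poly_of_eval; apply: eq_bigr => j _; rewrite mxE.
  by rewrite !e ic ic'.
apply: eq_bigr => j _; have := congr1 (fun A : 'cV_(N m n) => A j 0) E.
by rewrite !mxE => ->.
Qed.

Definition kappa (j : nat) : R := 2 ^+ code n (nth [::] (exponents m n) j).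

Lemma kappa_inj i j : (i < N m n)%N -> (j < N m n)%N -> kappa i = kappa j -> i = j.
Proof.
have ltr0n2 : 0 < 2 :> R by rewrite ltr0n.
have neq21 : 2 != 1 :> R by rewrite pnatr_eq1.
move=> ltiN ltjN /(ieexprIn ltr0n2 neq21).
have sz l : (l < N m n)%N -> (size (nth [::] (exponents m n) l) == m)
     && (sumn (nth [::] (exponents m n) l) <= n)%N.
  by move=> ltl; rewrite -mem_exponents mem_nth // size_exponents.
have /andP[/eqP si li] := sz _ ltiN; have /andP[/eqP sj lj] := sz _ ltjN.
move/code_inj; rewrite si sj => /(_ erefl li lj) /eqP.
by rewrite nth_uniq ?size_exponents ?uniq_exponents // => /eqP.
Qed.

Definition base (k : nat) : R := 2 ^+ (n.+1 ^ k).

Lemma kappaE (j : 'I_(N m n)) : kappa j = \prod_(k < m) base k ^+ monom m n j k.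
Proof.
have : nth [::] (exponents m n) j \in exponents m n by rewrite mem_nth ?size_exponents.
rewrite mem_exponents => /andP[/eqP sz _].
rewrite /kappa codeE sz (big_morph _ (exprD (2 : R)) (expr0 _)).
by apply: eq_bigr => k _; rewrite /base -exprM mnmE.
Qed.

(** Node [i] is the coordinatewise [i]-th power of one fixed point, and monomials commute with
    powers. *)
Lemma vandermonde_pow (P : 'M[R]_(N m n, m)) :
  (forall i k, P i k = base k ^+ i) -> vandermonde P = tvander (N m n) kappa.
Proof.
move=> EP; apply/matrixP => i j; rewrite !mxE kappaE -prodrXl.
by apply: eq_bigr => k _; rewrite EP -!exprM [(i * _)%N]mulnC.
Qed.

End Interpolation.

(** * Weakest preconditions *)

Section Wp.
Variables (R : realType) (m : nat) (f : 'rV[R]_m -> R) (cap : nat).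

(** Values are total here and safety is a separate boolean, so that side conditions become
    arithmetic goals instead of case analyses on options. *)
Fixpoint ival (s : state R) (e : iexp) : nat :=
  match e with
  | ILit k => k
  | IGet a => imem s (ival s a)
  | IAdd a b => ival s a + ival s b
  | ISub a b => ival s a - ival s b
  end.

Fixpoint iok (s : state R) (e : iexp) : bool :=
  match e with
  | ILit _ => true
  | IGet a => iok s a && (ival s a < cap)
  | IAdd a b | ISub a b => iok s a && iok s b
  end.

Fixpoint rval (s : state R) (e : rexp) : R :=
  match e with
  | RNat a => (ival s a)%:R
  | RGet a => rmem s (ival s a)
  | RAdd a b => rval s a + rval s b
  | RSub a b => rval s a - rval s b
  | RMul a b => rval s a * rval s b
  | RDiv a b => rval s a / rval s b
  end%R.

Fixpoint rok (s : state R) (e : rexp) : bool :=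
  match e with
  | RNat a => iok s a
  | RGet a => iok s a && (ival s a < cap)
  | RAdd a b | RSub a b | RMul a b => rok s a && rok s b
  | RDiv a b => [&& rok s a, rok s b & rval s b != 0%R]
  end.

Lemma ievalE s e : iok s e -> ieval cap s e = Some (ival s e).
Proof.
elim: e => //= [a IHa /andP[/IHa -> lt]|a IHa b IHb|a IHa b IHb].
- by rewrite /= /fetch lt.
- by case/andP=> /IHa -> /IHb ->.
- by case/andP=> /IHa -> /IHb ->.
Qed.

Lemma revalE s e : rok s e -> reval cap s e = Some (rval s e).
Proof.
elim: e => //= [a /ievalE -> //|a /andP[/ievalE -> lt]|||
               |a IHa b IHb /and3P[/IHa -> /IHb -> /= /negbTE -> //]].
- by rewrite /= /fetch lt.
all: by move=> a IHa b IHb /andP[/IHa -> /IHb ->].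
Qed.

(** Since execution is deterministic, existence of one run already expresses total correctness, with
    its exact cost. *)
Definition wp (c : cmd) (s : state R) (Q : nat -> state R -> Prop) : Prop :=
  exists t s', exec f cap c s t s' /\ Q t s'.

Lemma wp_conseq c s (Q Q' : nat -> state R -> Prop) :
  wp c s Q -> (forall t s', Q t s' -> Q' t s') -> wp c s Q'.
Proof. by move=> [t [s' [e q]]] QQ'; exists t, s'; split=> //; apply: QQ'. Qed.

Lemma wp_iset d e s (Q : nat -> state R -> Prop) :
  [&& iok s d, ival s d < cap & iok s e] ->
  Q (icost d + icost e).+1 (State (upd (imem s) (ival s d) (ival s e)) (rmem s)) ->
  wp (ISet d e) s Q.
Proof.
case/and3P=> okd lt oke q; eexists _, _; split; last exact: q.
by apply: ExecISet; rewrite ?ievalE.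
Qed.

Lemma wp_rset d e s (Q : nat -> state R -> Prop) :
  [&& iok s d, ival s d < cap & rok s e] ->
  Q (icost d + rcost e).+1 (State (imem s) (upd (rmem s) (ival s d) (rval s e))) ->
  wp (RSet d e) s Q.
Proof.
case/and3P=> okd lt oke q; eexists _, _; split; last exact: q.
by apply: ExecRSet; rewrite ?ievalE ?revalE.
Qed.

Lemma wp_call d e s (Q : nat -> state R -> Prop) :
  [&& iok s d, ival s d < cap, iok s e & ival s e + m <= cap] ->
  Q (icost d + icost e).+1 (State (imem s)
    (upd (rmem s) (ival s d) (f (\row_(k < m) rmem s (ival s e + k))%R))) ->
  wp (Call d e) s Q.
Proof.
case/and4P=> okd lt oke le q; eexists _, _; split; last exact: q.
by apply: ExecCall; rewrite ?ievalE.
Qed.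

Lemma wp_seq c1 c2 s (Q : nat -> state R -> Prop) :
  wp c1 s (fun t1 s1 => wp c2 s1 (fun t2 => Q (t1 + t2).+1)) ->
  wp (Seq c1 c2) s Q.
Proof.
case=> t1 [s1 [e1 [t2 [s2 [e2 q]]]]]; exists (t1 + t2).+1, s2; split=> //.
exact: ExecSeq e1 e2.
Qed.

Lemma wp_if x y c1 c2 s (Q : nat -> state R -> Prop) :
  iok s x && iok s y ->
  wp (if ival s x <= ival s y then c1 else c2) s
     (fun t => Q (bcost (BLeI x y) + t).+1) ->
  wp (If (BLeI x y) c1 c2) s Q.
Proof.
case/andP=> okx oky [t [s' [e q]]]; eexists _, s'; split; last exact: q.
by apply: ExecIf e; rewrite /= !ievalE.
Qed.

(** The number [L] of rounds is known in advance, so an invariant indexed by rounds done and time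
    spent replaces a termination measure. The last, failing test is charged in the postcondition. *)
Lemma wp_while (L : nat) (Inv : nat -> nat -> state R -> Prop) x y c s
    (Q : nat -> state R -> Prop) :
  Inv 0 0 s ->
  (forall j t s', j <= L -> Inv j t s' ->
     [/\ iok s' x, iok s' y & (ival s' x <= ival s' y) = (j < L)]) ->
  (forall j t s', j < L -> Inv j t s' ->
     wp c s' (fun t' => Inv j.+1 (t + (bcost (BLeI x y) + t').+1))) ->
  (forall t s', Inv L t s' -> Q (t + (bcost (BLeI x y)).+1) s') ->
  wp (While (BLeI x y) c) s Q.
Proof.
move=> inv0 guard body post; set b := BLeI x y in body post *.
have guardE j t s' : j <= L -> Inv j t s' -> beval cap s' b = Some (j < L).
  by move=> le /(guard _ _ _ le)[okx oky <-]; rewrite /= !ievalE.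
suff H d j t s' : j + d = L -> Inv j t s' ->
    wp (While b c) s' (fun t' => Q (t + t')) by apply: (H L 0 0).
elim: d j t s' => [|d IHd] j t s' jd inv.
  exists (bcost b).+1, s'; split; last by apply: post; rewrite -jd addn0.
  by apply: ExecWhileStop; rewrite (guardE _ _ _ _ inv) // -jd ?addn0 ?ltnn.
have jL : j < L by rewrite -jd addnS ltnS leq_addr.
have [t1 [s1 [e1 inv1]]] := body j t s' jL inv.
have [|t2 [s2 [e2 q]]] := IHd _ _ _ _ inv1; first by rewrite addSnnS.
exists (bcost b + t1 + t2).+1, s2; split.
  by apply: ExecWhileStep e1 e2; rewrite (guardE _ _ _ _ inv) ?jL // ltnW.
by have -> : t + (bcost b + t1 + t2).+1 = t + (bcost b + t1).+1 + t2 by lia.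
Qed.

End Wp.

Declare Scope cmd_scope.
Delimit Scope cmd_scope with cmd.
Notation "c1 ;; c2" := (Seq c1 c2) (at level 99, right associativity) : cmd_scope.
Notation ireg r := (IGet (ILit r)).
Notation rreg r := (RGet (ILit r)).
Open Scope cmd_scope.

Definition incr r := ISet (ILit r) (IAdd (ireg r) (ILit 1)).

(** Aliasing between memory cells is resolved by deciding each address comparison with linear
    arithmetic. *)
Ltac eqn_simp := repeat match goal with
  |- context [@eq_op _ ?a ?b] =>
     first [ have -> : (a == b :> nat) = false by lia
           | have -> : (a == b :> nat) = true by lia ]
  end.
Ltac upds := rewrite /upd /=; eqn_simp; rewrite /=.
Ltac ok := rewrite /=; upds; lia.
Ltac step := lazymatch goal with
  | |- wp _ _ (Seq _ _) _ _ => apply: wp_seq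
  | |- wp _ _ (ISet _ _) _ _ => apply: wp_iset; first by ok
  | |- wp _ _ (RSet _ _) _ _ => apply: wp_rset; first by ok
  | |- wp _ _ (Call _ _) _ _ => apply: wp_call; first by ok
  | |- wp _ _ (If _ _ _) _ _ => apply: wp_if; first by ok
  | |- wp _ _ (incr _) _ _ => apply: wp_iset; first by ok
  end.

(** * The program *)

(* Integer registers: 0 = m, 1 = n, 7 = N(m,n); 3, 8, 9, 10, 11 = addresses of
   the x_e, of the coefficients of M, of the values of f, of the solution, and of
   the nodes; 2, 6, 13 = counters; 4, 5, 12 = moving addresses.  The q_k are in
   the real cells 16 + k.  During the enumeration, the integer and the real cell
   of one address hold |e| and x_e; for each k, the vectors of length k+1 are
   appended behind those of length k, from which they are obtained. *)
Definition emit : cmd :=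
  While (BLeI (ireg 6) (ireg 1)) (
    ISet (ireg 4) (ireg 6) ;;
    RSet (ireg 4) (rreg 1) ;;
    RSet (ILit 1) (RMul (rreg 1) (rreg 0)) ;;
    incr 4 ;;
    incr 6).

(** Cell 4 grows during the loop, whereas cell 5 stays at the end of the current level, so only this
    level is visited. *)
Definition expand : cmd :=
  While (BLeI (IAdd (ireg 3) (ILit 1)) (ireg 5)) (
    ISet (ILit 6) (IGet (ireg 3)) ;;
    RSet (ILit 1) (RGet (ireg 3)) ;;
    emit ;;
    incr 3).

(** Passes from q_k to q_(k+1), its power with exponent n+1. *)
Definition power : cmd :=
  ISet (ILit 6) (ILit 0) ;;
  RSet (ILit 1) (rreg 0) ;;
  While (BLeI (IAdd (ireg 6) (ILit 1)) (ireg 1)) (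
    RSet (ILit 0) (RMul (rreg 0) (rreg 1)) ;;
    incr 6).

Definition levels : cmd :=
  While (BLeI (IAdd (ireg 2) (ILit 1)) (ireg 0)) (
    RSet (IAdd (ILit 16) (ireg 2)) (rreg 0) ;;
    ISet (ILit 5) (ireg 4) ;;
    expand ;;
    power ;;
    incr 2).

Definition queue : cmd :=
  RSet (ILit 0) (RNat (ILit 2)) ;;
  ISet (ILit 3) (IAdd (ILit 16) (ireg 0)) ;;
  RSet (ireg 3) (RNat (ILit 1)) ;;
  ISet (ILit 4) (IAdd (ireg 3) (ILit 1)) ;;
  levels.

(** Going downwards, the lower neighbour that is read still has its old value. Every round sweeps
    all positions; those above the current degree hold 0. *)
Definition expand_master : cmd :=
  RSet (ireg 8) (RNat (ILit 1)) ;;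
  ISet (ILit 13) (ILit 0) ;;
  While (BLeI (IAdd (ireg 13) (ILit 1)) (ireg 7)) (
    RSet (ILit 1) (RGet (IAdd (ireg 3) (ireg 13))) ;;
    ISet (ILit 6) (ireg 7) ;;
    While (BLeI (ILit 1) (ireg 6)) (
      RSet (IAdd (ireg 8) (ireg 6))
        (RSub (RGet (ISub (IAdd (ireg 8) (ireg 6)) (ILit 1)))
              (RMul (rreg 1) (RGet (IAdd (ireg 8) (ireg 6))))) ;;
      ISet (ILit 6) (ISub (ireg 6) (ILit 1))) ;;
    RSet (ireg 8) (RSub (RNat (ILit 0)) (RMul (rreg 1) (RGet (ireg 8)))) ;;
    incr 13).

(** The same coordinate of the previous node lies m cells back, so each coordinate costs one
    multiplication. *)
Definition sample : cmd :=
  ISet (ILit 12) (ireg 11) ;;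
  ISet (ILit 13) (ILit 0) ;;
  While (BLeI (IAdd (ireg 13) (ILit 1)) (ireg 7)) (
    ISet (ILit 2) (ILit 0) ;;
    While (BLeI (IAdd (ireg 2) (ILit 1)) (ireg 0)) (
      If (BLeI (ireg 13) (ILit 0))
        (RSet (ireg 12) (RNat (ILit 1)))
        (RSet (ireg 12) (RMul (RGet (ISub (ireg 12) (ireg 0)))
                              (RGet (IAdd (ILit 16) (ireg 2))))) ;;
      incr 12 ;;
      incr 2) ;;
    Call (IAdd (ireg 9) (ireg 13)) (ISub (ireg 12) (ireg 0)) ;;
    incr 13).

(** A single downward pass keeps the current quotient coefficient in real cell 2, its Horner value
    at x_e in cell 3 and the weighted sum of values of f in cell 4. The quotient itself is never
    stored. *)
Definition solve : cmd :=
  ISet (ILit 13) (ILit 0) ;;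
  While (BLeI (IAdd (ireg 13) (ILit 1)) (ireg 7)) (
    RSet (ILit 1) (RGet (IAdd (ireg 3) (ireg 13))) ;;
    RSet (ILit 2) (RNat (ILit 0)) ;;
    RSet (ILit 3) (RNat (ILit 0)) ;;
    RSet (ILit 4) (RNat (ILit 0)) ;;
    ISet (ILit 6) (ireg 7) ;;
    While (BLeI (ILit 1) (ireg 6)) (
      RSet (ILit 2) (RAdd (RMul (rreg 2) (rreg 1)) (RGet (IAdd (ireg 8) (ireg 6)))) ;;
      RSet (ILit 3) (RAdd (RMul (rreg 3) (rreg 1)) (rreg 2)) ;;
      ISet (ILit 6) (ISub (ireg 6) (ILit 1)) ;;
      RSet (ILit 4) (RAdd (rreg 4) (RMul (rreg 2) (RGet (IAdd (ireg 9) (ireg 6)))))) ;;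
    RSet (IAdd (ireg 10) (ireg 13)) (RDiv (rreg 4) (rreg 3)) ;;
    incr 13).

(** For n = 0 the zero cells from 1 on serve as the node, and its value in cell 0 as the only
    coefficient. *)
Definition interpolation_program : cmd :=
  If (BLeI (ireg 1) (ILit 0))
    (Call (ILit 0) (ILit 1) ;;
     ISet (ILit 0) (ILit 1) ;;
     ISet (ILit 1) (ILit 0))
    (queue ;;
     ISet (ILit 7) (ISub (ireg 4) (ireg 3)) ;;
     ISet (ILit 8) (ireg 4) ;;
     ISet (ILit 9) (IAdd (IAdd (ireg 8) (ireg 7)) (ILit 1)) ;;
     ISet (ILit 10) (IAdd (ireg 9) (ireg 7)) ;;
     ISet (ILit 11) (IAdd (ireg 10) (ireg 7)) ;;
     expand_master ;;
     sample ;;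
     solve ;;
     ISet (ILit 0) (ireg 11) ;;
     ISet (ILit 1) (ireg 10)).

(** * Correctness and cost *)

Section Expansion.
Variables (R : realType) (m n : nat) (f : 'rV[R]_m -> R) (cap : nat).
Hypothesis cap16 : 16 <= cap.
Local Notation wp := (wp f cap).

(** Here [d] and [x] are |e| and x_e for one vector e; appending [l] adds [l] to the former and
    multiplies the latter by [q ^+ l]. The summand 6 pays for the failing test. *)
Lemma wp_emit s T d x q :
  imem s 1 = n -> imem s 4 = T -> imem s 6 = d -> rmem s 0 = q -> rmem s 1 = x ->
  16 <= T -> d <= n -> T + (n.+1 - d) <= cap ->
  wp emit s (fun t (s' : state R) => [/\ t <= 50 * (n.+1 - d) + 6,
    imem s' 4 = T + (n.+1 - d),
    (forall l, l < n.+1 - d ->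
       imem s' (T + l) = d + l /\ rmem s' (T + l) = (x * q ^+ l)%R),
    (forall a : nat, a < T -> a != 4 -> a != 6 -> imem s' a = imem s a) &
    (forall a : nat, a != 1 -> (a < T) || (T + (n.+1 - d) <= a) -> rmem s' a =
      rmem s a)]).
Proof.
move=> E1 E4 E6 Eq Ex leT led lec.
pose Inv (j t : nat) (s' : state R) := [/\ [/\ t <= 50 * j, imem s' 4 = T + j,
  imem s' 6 = d + j & rmem s' 1 = (x * q ^+ j)%R],
    (forall l, l < j ->
       imem s' (T + l) = d + l /\ rmem s' (T + l) = (x * q ^+ l)%R),
    (forall a : nat, a < T -> a != 4 -> a != 6 -> imem s' a = imem s a) &
    (forall a : nat, a != 1 -> (a < T) || (T + j <= a) -> rmem s' a = rmem s a)].
apply: (@wp_while _ _ _ _ (n.+1 - d) Inv).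
- by split; rewrite ?addn0 ?expr0 ?mulr1.
- move=> j t s' le [[_ e4 e6 _] _ fi _].
  have e1 : imem s' 1 = n by rewrite fi //; lia.
  by rewrite /=; split; lia.
- move=> j t s' lt [[le e4 e6 er] blk fi fr].
  do !step.
  rewrite /Inv; split.
  + split; rewrite /=; upds; try lia.
    rewrite er fr ?Eq ?exprSr ?mulrA //; lia.
  + move=> l; rewrite ltnS leq_eqVlt => /orP[/eqP ->|ltl]; upds.
      by split; [lia|].
    by have [<- <-] := blk l ltl.
  + by move=> a lta n4 n6; upds; rewrite fi.
  + by move=> a na h; upds; rewrite fr //; lia.
- move=> t s' [[le e4 e6 er] blk fi fr]; split=> //; rewrite /=; lia.
Qed.

(** The sum is stored beside the value because it tells how far the next coordinate may range. *)
Definition enc (s : state R) (a : nat) (E : seq (seq nat)) : Prop :=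
  forall i, i < size E -> imem s (a + i) = sumn (nth [::] E i) /\
    rmem s (a + i) = (2 ^+ code n (nth [::] E i))%R.

Lemma enc_cat s a E1 E2 :
  enc s a E1 -> enc s (a + size E1) E2 -> enc s a (E1 ++ E2).
Proof.
move=> e1 e2 i; rewrite size_cat nth_cat => lt; case: (ltnP i (size E1)) => [lt1|le].
  exact: e1.
by have := e2 (i - size E1); rewrite -addnA subnKC //; apply; lia.
Qed.

Definition kids (e : seq nat) : seq (seq nat) :=
  [seq rcons e i | i <- iota 0 (n - sumn e).+1].

(** Time is charged to the vectors read as well as to those written. *)
Lemma wp_expand s k E h T (E' := flatten [seq kids e | e <- E]) :
  (forall e, e \in E -> size e = k /\ sumn e <= n) ->
  imem s 1 = n -> imem s 3 = h -> imem s 4 = T -> imem s 5 = T ->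
  T = h + size E -> 16 <= h -> T + size E' <= cap ->
  rmem s 0 = base R n k -> enc s h E ->
  wp expand s (fun t (s' : state R) => [/\
    [/\ t <= 100 * (size E + size E') + 10, imem s' 3 = T & imem s' 4 = T + size E'],
    enc s' T E',
    (forall a : nat, a < T -> a != 3 -> a != 4 -> a != 6 -> imem s' a = imem s a) &
    (forall a : nat, a != 1 -> (a < T) || (T + size E' <= a) -> rmem s' a = rmem s a)]).
Proof.
move=> HE E1 E3 E4 E5 ET leh lec Eq encE.
pose K j := flatten [seq kids e | e <- take j E].
pose Inv (j t : nat) (s' : state R) := [/\
    [/\ t <= 100 * (j + size (K j)), imem s' 3 = h + j & imem s' 4 = T + size (K j)],
    enc s' T (K j),
    (forall a : nat, a < T -> a != 3 -> a != 4 -> a != 6 -> imem s' a = imem s a) &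
    (forall a : nat, a != 1 -> (a < T) || (T + size (K j) <= a) -> rmem s' a =
      rmem s a)].
have sK j : j < size E -> K j.+1 = K j ++ kids (nth [::] E j).
  by move=> lt; rewrite /K (take_nth [::] lt) map_rcons flatten_rcons.
have leK j : size (K j) <= size E'.
  by rewrite /E' -[in leqRHS](cat_take_drop j E) map_cat flatten_cat size_cat leq_addr.
apply: (@wp_while _ _ _ _ (size E) Inv).
- by rewrite /Inv /K take0 /= !addn0; split.
- move=> j t s' le [[_ e3 e4] _ fi _].
  have e5 : imem s' 5 = T by rewrite fi //; lia.
  by rewrite /=; split; lia.
- move=> j t s' lt [[le e3 e4] blk fi fr].
  have [sze sume] : size (nth [::] E j) = k /\ sumn (nth [::] E j) <= n.
    by apply: HE; apply: mem_nth.
  have leKj := leK j.+1; rewrite sK // size_cat size_map size_iota in leKj.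
  have [encj rencj] := encE j lt.
  do !step.
  apply: wp_conseq.
    apply: (@wp_emit _ (T + size (K j)) (sumn (nth [::] E j)) (2 ^+ code n (nth [::]
      E j)) (base R n k)) => //=; upds; try lia.
    + by rewrite fi //; lia.
    + by rewrite e3 fi //; lia.
    + by rewrite fr // ?orbT //; lia.
    + by rewrite e3 fr //; lia.
  move=> t1 s2 [le1 f4 blk2 fi2 fr2].
  have f3 : imem s2 3 = h + j by rewrite fi2 /= //; upds; lia.
  step.
  rewrite /Inv sK // size_cat size_map size_iota.
  split.
  + split; rewrite /=; upds; lia.
  + apply: enc_cat => i.
      move=> lti; have [<- <-] := blk i lti; upds; rewrite fi2 ?fr2 /=; try lia;
        upds; split=> //.
    rewrite size_map size_iota => lti; rewrite (nth_map 0) ?size_iota // nth_iota //.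
    have [|f7 f8] := blk2 i; first lia.
    by rewrite code_rcons sze exprD /base exprM sumn_rcons /=; upds; rewrite f7 f8;
      split.
  + move=> a lta n3 n4 n6; rewrite /=; upds; rewrite fi2 //=; try lia; upds.
    by rewrite fi.
  + move=> a na ha; rewrite /= fr2 //=; try lia; upds.
    by rewrite fr //; lia.
- by move=> t s'; rewrite /Inv /K take_size -/E' => -[[le e3 e4] blk fi fr];
    split=> //; split=> //=; lia.
Qed.

End Expansion.

(** * Enumeration of all the x_e *)

Section Enumeration.
Variables (R : realType) (m n : nat) (f : 'rV[R]_m -> R) (cap : nat).
Hypothesis cap16 : 16 <= cap.
Local Notation wp := (wp f cap).

Lemma wp_power s q : imem s 1 = n -> rmem s 0 = q ->
  wp power s (fun t (s' : state R) => [/\ t <= 50 * n.+1, rmem s' 0 = (q ^+ n.+1)%R,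
    (forall a : nat, a != 6 -> imem s' a = imem s a) &
    (forall a : nat, a != 0 -> a != 1 -> rmem s' a = rmem s a)]).
Proof.
move=> E1 Eq.
(* Cell 0 already starts at [q], so [n] rounds reach the exponent [n.+1]. *)
pose Inv (j t : nat) (s' : state R) := [/\ t <= 30 * j, rmem s' 0 = (q ^+ j.+1)%R,
    imem s' 6 = j /\ rmem s' 1 = q,
    (forall a : nat, a != 6 -> imem s' a = imem s a) &
    (forall a : nat, a != 0 -> a != 1 -> rmem s' a = rmem s a)].
rewrite /power; do 4!step.
apply: (@wp_while _ _ _ _ n Inv).
- split.
  + by [].
  + by rewrite /=; upds; rewrite Eq expr1.
  + by rewrite /=; upds.
  + by move=> a na; rewrite /=; upds.
  + by move=> a n0 n1; rewrite /=; upds.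
- move=> j t s' le [_ _ [e6 _] fi _].
  have e1 : imem s' 1 = n by rewrite fi.
  by rewrite /=; split; lia.
- move=> j t s' lt [le e0 [e6 er] fi fr].
  do !step; split.
  + by rewrite /=; lia.
  + by rewrite /=; upds; rewrite e0 er [in RHS]exprSr.
  + by rewrite /=; upds; split; [lia|].
  + by move=> a na; rewrite /=; upds; rewrite fi.
  + by move=> a n0 n1; rewrite /=; upds; rewrite fr.
- move=> t s' [le e0 _ fi fr]; split=> //; rewrite /=; lia.
Qed.

Lemma size_expand k : size (flatten [seq kids n e | e <- exponents k n]) = N k.+1 n.
Proof. by rewrite -size_exponents exponents_rcons. Qed.

(** Levels of at most [N m n] entries are laid end to end, whence the bounds of order [m * N m n].
    The cells behind the queue are tracked as zero because [expand_master] builds its polynomial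
    there. *)
Lemma wp_levels s h0 :
  imem s 0 = m -> imem s 1 = n -> imem s 2 = 0 -> imem s 3 = h0 ->
  imem s 4 = h0.+1 -> h0 = 16 + m -> imem s h0 = 0 -> rmem s h0 = 1%R ->
  (forall a : nat, h0 < a -> rmem s a = 0%R) -> rmem s 0 = 2%R ->
  17 + m + m * N m n <= cap ->
  wp levels s (fun t (s' : state R) => exists h : nat,
    [/\ [/\ t <= 500 * (m * N m n) + 10, imem s' 0 = m,
      imem s' 3 = h & imem s' 4 = h + N m n],
        16 + m <= h /\ h + N m n <= 17 + m + m * N m n,
        (forall k, k < m -> rmem s' (16 + k) = base R n k),
        (forall j, j < N m n -> rmem s' (h + j) = kappa R m n j) &
        (forall a : nat, h + N m n <= a -> rmem s' a = 0%R)]).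
Proof.
move=> E0 E1 E2 E3 E4 Eh Ed Ex Ez Eq lec.
pose Inv (k t : nat) (s' : state R) := exists h : nat,
  [/\ [/\ t <= 500 * (k * N m n), imem s' 0 = m, imem s' 1 = n, imem s' 2 = k &
          imem s' 3 = h],
      [/\ imem s' 4 = h + N k n, 16 + m <= h,
        h + N k n <= 17 + m + k * N m n & rmem s' 0 = base R n k],
      (forall l, l < k -> rmem s' (16 + l) = base R n l),
      enc n s' h (exponents k n) &
      (forall a : nat, h + N k n <= a -> rmem s' a = 0%R)].
apply: (@wp_while _ _ _ _ m Inv).
- exists h0; have N0 : N 0 n = 1 by rewrite /N bin0.
  split=> //; rewrite ?N0 ?addn1 //.
  + by split=> //; lia.
  + by case=> // _; rewrite addn0 Ed Ex.
- by move=> k t s' le [h [[_ e0 e1 e2 e3] _ _ _ _]]; rewrite /=; split; lia.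
- move=> k t s' lt [h [[le e0 e1 e2 e3] [e4 leh leT eq] eb ee ez]].
  have Nk1 : N k n <= N m n by apply: leq_N; lia.
  have Nk2 : N k.+1 n <= N m n by apply: leq_N.
  (* This absorbs the O(n) cost of [power] on each level. *)
  have nN : n <= N m n.
    apply: leq_trans (ltnW (ltn_mul_N m n)).
    by rewrite leq_pmull // (leq_ltn_trans _ lt).
  have N1 := N_gt0 m n.
  have le1 : k.+1 * N m n <= m * N m n by rewrite leq_mul2r lt orbT.
  rewrite mulSn in le1.
  do 5!step.
  apply: wp_conseq.
    apply: (@wp_expand _ _ n _ _ cap16 _ k (exponents k n) h (h + N k n)) => //=;
      upds; try lia.
    + by move=> e; rewrite mem_exponents => /andP[/eqP].
    + by rewrite size_exponents.
    + by rewrite size_expand; lia.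
    + move=> i lti; have [<- <-] := ee i lti; rewrite /=; upds.
      by split.
  rewrite size_expand size_exponents => t1 s1 [[t1le f3 f4] encK fi fr].
  step; apply: wp_conseq.
    by apply: (@wp_power _ (base R n k)); rewrite ?fi ?fr //=; upds; lia.
  move=> t2 s2 [t2le f0 fi2 fr2].
  have g r : r < 3 -> imem s2 r = imem s' r.
    by move=> ltr; rewrite fi2 ?fi /=; upds; lia.
  have g3 : imem s2 3 = h + N k n by rewrite fi2.
  have g4 : imem s2 4 = h + N k n + N k.+1 n by rewrite fi2.
  step.
  exists (h + N k n); split.
  + split; rewrite /=; upds; rewrite ?(g 0) ?(g 1) ?(g 2) //; lia.
  + split; rewrite /=; upds; try lia.
    by rewrite f0 /base expnSr exprM.
  + move=> l; rewrite ltnS leq_eqVlt => /orP[/eqP ->|ltl]; rewrite /= fr2 ?fr //=;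
      upds; try lia.
      by [].
    exact: eb.
  + rewrite exponents_rcons => i lti; have [<- <-] := encK i lti.
    by rewrite /=; upds; rewrite fi2 ?fr2 //; lia.
  + by move=> a lea; rewrite /= fr2 ?fr //=; upds; rewrite ?ez //; lia.
- move=> t s' [h [[le e0 e1 e2 e3] [e4 leh leT eq] eb ee ez]]; exists h; split=> //.
    by split=> //=; lia.
  by move=> j ltj; have [|_ ->] := ee j; rewrite ?size_exponents.
Qed.

Lemma wp_queue :
  17 + m + m * N m n <= cap ->
  wp queue (init R m n) (fun t (s' : state R) => exists h : nat,
    [/\ [/\ t <= 500 * (m * N m n) + 50, imem s' 0 = m,
      imem s' 3 = h & imem s' 4 = h + N m n],
        16 + m <= h /\ h + N m n <= 17 + m + m * N m n,
        (forall k, k < m -> rmem s' (16 + k) = base R n k),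
        (forall j, j < N m n -> rmem s' (h + j) = kappa R m n j) &
        (forall a : nat, h + N m n <= a -> rmem s' a = 0%R)]).
Proof.
move=> lec; rewrite /queue; do 8!step.
apply: wp_conseq.
  apply: (@wp_levels _ (16 + m)) => //=; upds => //; rewrite ?addn1 //.
  by move=> a lta; upds.
move=> t s' [h [[le e0 e3 e4] leh eb ek ez]]; exists h; split=> //.
by split=> //=; lia.
Qed.

End Enumeration.

(** * Master polynomial, sampling of f, and solution *)

Section LinearSystem.
Variables (R : realType) (m : nat) (f : 'rV[R]_m -> R) (cap : nat).
Hypothesis cap16 : 16 <= cap.
Local Notation wp := (wp f cap).

Lemma wp_expand_master (s : state R) (h M L : nat) (x : nat -> R) :
  imem s 3 = h -> imem s 7 = L -> imem s 8 = M ->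
  (forall j, j < L -> rmem s (h + j) = x j) ->
  (forall i, i <= L -> rmem s (M + i) = 0%R) ->
  16 <= h -> h + L <= M -> M + L < cap ->
  wp expand_master s (fun t (s' : state R) => [/\ t <= L * (60 * L + 100) + 50,
    (forall i, i <= L -> rmem s' (M + i) = ((master x L)`_i)%R),
    (forall a : nat, a != 6 -> a != 13 -> imem s' a = imem s a) &
    (forall a : nat, a != 1 -> (a < M) || (M + L < a) -> rmem s' a = rmem s a)]).
Proof.
move=> E3 E7 E8 Ex Ez leh lehM lec; rewrite /expand_master; do 4!step.
pose Inv (j t : nat) (s' : state R) := [/\ t <= j * (60 * L + 100), imem s' 13 = j,
    (forall i, i <= L -> rmem s' (M + i) = ((master x j)`_i)%R),
    (forall a : nat, a != 6 -> a != 13 -> imem s' a = imem s a) &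
    (forall a : nat, a != 1 -> (a < M) || (M + L < a) -> rmem s' a = rmem s a)].
apply: (@wp_while _ _ _ _ L Inv).
- split=> //.
  + move=> i lei; rewrite /master big_ord0 coef1 /=.
    case: eqP => [->|ni]; upds; first by [].
    by rewrite Ez.
  + by move=> a n6 n13; rewrite /=; upds.
  + by move=> a n1 na; rewrite /=; upds.
- move=> j t s' le [_ e13 _ fi _].
  have e7 : imem s' 7 = L by rewrite fi.
  by rewrite /=; split; lia.
- move=> j t s' lt [le e13 eM fi fr].
  have e3 : imem s' 3 = h by rewrite fi.
  have e7 : imem s' 7 = L by rewrite fi.
  have e8 : imem s' 8 = M by rewrite fi.
  do 5!step.
  (* Positions above [L - l] are updated, the others still old; at the end only the constant term is
     left, for the instruction after the loop. *)
  pose Inv2 (l t : nat) (s2 : state R) := [/\ t <= 40 * l,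
    imem s2 6 = L - l /\ rmem s2 1 = x j,
    (forall i, i <= L -> rmem s2 (M + i) =
       if i <= L - l then ((master x j)`_i)%R else ((master x j.+1)`_i)%R),
    (forall a : nat, a != 6 -> imem s2 a = imem s' a) &
    (forall a : nat, a != 1 -> (a < M) || (M + L < a) -> rmem s2 a = rmem s' a)].
  apply: (@wp_while _ _ _ _ L Inv2).
  + split=> //=.
    * by upds; rewrite subn0 e3 e13 fr ?Ex //; lia.
    * by move=> i lei; upds; rewrite subn0 lei eM.
    * by move=> a n6; upds.
    * by move=> a n1 na; upds.
  + by move=> l t2 s2 lel [_ [e6 _] _ _ _]; rewrite /=; split; lia.
  + move=> l t2 s2 ltl [le2 [f6 f1] fM fi2 fr2].
    have f8 : imem s2 8 = M by rewrite fi2.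
    do 3!step.
    split; rewrite /=.
    * by lia.
    * by upds; split; [lia|].
    * move=> i lei; upds; case: ifP => [/eqP Ei|ni]; last first.
        rewrite fM //; case: (leqP i (L - l)) => c1;
          case: (leqP i (L - l.+1)) => c2 //; lia.
      have -> : imem s2 8 + imem s2 6 - 1 = M + i.-1 by lia.
      have -> : imem s2 8 + imem s2 6 = M + i by lia.
      rewrite !fM; try lia.
      rewrite f1.
      have -> : i <= L - l by lia.
      have -> : i.-1 <= L - l by lia.
      have -> : (i <= L - l.+1) = false by lia.
      by rewrite masterS; have -> : (i == 0) = false by lia.
    * by move=> a n6; upds; rewrite fi2.
    * by move=> a n1 na; upds; rewrite fr2.
  + move=> t2 s2 [le2 [f6 f1] fM fi2 fr2].
    have f8 : imem s2 8 = M by rewrite fi2.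
    have f13 : imem s2 13 = j by rewrite fi2.
    do 3!step.
    split; rewrite /=.
    * by lia.
    * by upds; lia.
    * move=> i lei; upds; case: ifP => [/eqP Ei|ni].
        have -> : imem s2 8 = M + 0 by lia.
        have -> : i = 0 by lia.
        by rewrite fM // f1 masterS.
      rewrite fM // subnn leqn0.
      by have -> : (i == 0) = false by lia.
    * by move=> a n6 n13; upds; rewrite fi2 // fi.
    * by move=> a n1 na; upds; rewrite fr2 // fr.
- by move=> t s' [le e13 eM fi fr]; split=> //=; lia.
Qed.

Lemma wp_sample (s : state R) (L F P : nat) (q : nat -> R) :
  imem s 0 = m -> imem s 7 = L -> imem s 9 = F -> imem s 11 = P ->
  (forall k, k < m -> rmem s (16 + k) = q k) ->
  16 + m <= F -> F + L <= P -> P + L * m <= cap ->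
  wp sample s (fun t (s' : state R) => [/\ t <= L * (100 * m + 100) + 50,
    (forall i k, i < L -> k < m -> rmem s' (P + i * m + k) = (q k ^+ i)%R),
    (forall i, i < L -> rmem s' (F + i) = f (\row_(k < m) q k ^+ i)%R),
    (forall a : nat, a != 2 -> a != 12 -> a != 13 -> imem s' a = imem s a) &
    (forall a : nat, (a < F) || (F + L <= a < P) -> rmem s' a = rmem s a)]).
Proof.
move=> E0 E7 E9 E11 Eq leF leP lec; rewrite /sample; do 4!step.
pose Inv (j t : nat) (s' : state R) := [/\ t <= j * (100 * m + 100),
    imem s' 13 = j /\ imem s' 12 = P + j * m,
    (forall i k, i < j -> k < m -> rmem s' (P + i * m + k) = (q k ^+ i)%R) /\
    (forall i, i < j -> rmem s' (F + i) = f (\row_(k < m) q k ^+ i)%R),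
    (forall a : nat, a != 2 -> a != 12 -> a != 13 -> imem s' a = imem s a) &
    (forall a : nat, (a < F) || (F + L <= a < P) -> rmem s' a = rmem s a)].
apply: (@wp_while _ _ _ _ L Inv).
- split=> //.
  + by rewrite /=; upds; split=> //; rewrite addn0.
  + by move=> a n2 n12 n13; rewrite /=; upds.
- move=> j t s' le [_ [e13 _] _ fi _].
  have e7 : imem s' 7 = L by rewrite fi.
  by rewrite /=; split; lia.
- move=> j t s' lt [le [e13 e12] [eP eF] fi fr].
  have e0 : imem s' 0 = m by rewrite fi.
  have e7 : imem s' 7 = L by rewrite fi.
  have e9 : imem s' 9 = F by rewrite fi.
  have eq k : k < m -> rmem s' (16 + k) = q k.
    by move=> ltk; rewrite fr ?Eq //; lia.
  have leL : j * m + m <= L * m by rewrite -mulSnr leq_mul2r lt orbT.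
  do 3!step.
  (* The coordinates written so far are those lexicographically before [(j, k)]. *)
  pose Inv2 (k t : nat) (s2 : state R) := [/\ t <= 80 * k,
    imem s2 2 = k /\ imem s2 12 = P + j * m + k,
    (forall i k', (i < j) && (k' < m) || (i == j) && (k' < k) ->
      rmem s2 (P + i * m + k') = (q k' ^+ i)%R),
    (forall a : nat, a != 2 -> a != 12 -> imem s2 a = imem s' a) &
    (forall a : nat, a < P -> rmem s2 a = rmem s' a)].
  apply: (@wp_while _ _ _ _ m Inv2).
  + split=> //=.
    * by upds; split; lia.
    * by move=> i k; rewrite ltn0 andbF orbF => /andP[]; apply: eP.
    * by move=> a n2 n12; upds.
  + move=> k t2 s2 lek [_ [f2 _] _ fi2 _].
    have f0 : imem s2 0 = m by rewrite fi2.
    by rewrite /=; split; lia.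
  + move=> k t2 s2 ltk [le2 [f2 f12] fP fi2 fr2].
    have f0 : imem s2 0 = m by rewrite fi2.
    have f13 : imem s2 13 = j by rewrite fi2.
    have old i k' : (i < j) && (k' < m) || (i == j) && (k' < k) ->
        P + i * m + k' != P + j * m + k.
      case/orP=> [/andP[lti ltk']|/andP[/eqP -> ltk']]; last by lia.
      by have := mul_addr_lt lti ltk'; lia.
    have new i k' : (i < j) && (k' < m) || (i == j) && (k' < k.+1) ->
        (i < j) && (k' < m) || (i == j) && (k' < k) \/ i = j /\ k' = k.
      case/orP=> [->|/andP[/eqP -> ltk']]; first by left.
      move: ltk'; rewrite ltnS leq_eqVlt eqxx => /orP[/eqP ->|->]; first by right.
      by left; rewrite orbT.
    do 2!step; rewrite [ival _ (ireg 13)]/= f13 [ival _ (ILit 0)]/= leqn0.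
    case: (eqVneq j 0) => [j0|jn0].
    * do 4!step; split; rewrite /=.
      - by lia.
      - by upds; split; lia.
      - move=> i k' /new[o|[-> ->]]; [have no := old i k' o|]; upds;
          last by rewrite j0 expr0; upds.
        by rewrite fP.
      - by move=> a n2 n12; upds; rewrite fi2.
      - by move=> a lta; upds; rewrite fr2.
    * have jE : j * m = j.-1 * m + m by rewrite -mulSnr prednK // lt0n.
      do 4!step; split; rewrite /=.
      - by lia.
      - by upds; split; lia.
      - move=> i k' /new[o|[-> ->]]; [have no := old i k' o|]; upds.
          by rewrite fP.
        have -> : imem s2 12 - imem s2 0 = P + j.-1 * m + k by lia.
        rewrite fP; last by apply/orP; left; apply/andP; split; lia.
        rewrite f2 fr2 ?eq //; last by lia.
        by rewrite -exprSr prednK // lt0n.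
      - by move=> a n2 n12; upds; rewrite fi2.
      - by move=> a lta; upds; rewrite fr2.
  + move=> t2 s2 [le2 [f2 f12] fP fi2 fr2].
    have f0 : imem s2 0 = m by rewrite fi2.
    have f9 : imem s2 9 = F by rewrite fi2.
    have f13 : imem s2 13 = j by rewrite fi2.
    do 3!step; split; rewrite /=.
    * by lia.
    * by upds; split; [lia|rewrite mulSn; lia].
    * split=> [i k lti ltk|i lti]; upds.
        by rewrite fP //; lia.
      case: ifP => [/eqP Ei|ni]; last first.
        by rewrite fr2 ?eF //; lia.
      have -> : i = j by lia.
      congr f; apply/rowP => k; rewrite !mxE.
      have -> : imem s2 12 - imem s2 0 + k = P + j * m + k by lia.
      by rewrite fP // eqxx ltn_ord orbT.
    * by move=> a n2 n12 n13; upds; rewrite fi2 // fi.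
    * by move=> a na; upds; rewrite fr2 ?fr //; lia.
- by move=> t s' [le [e13 e12] [eP eF] fi fr]; split=> //=; lia.
Qed.

Lemma wp_solve (s : state R) (h L M F C : nat) (x y : nat -> R) :
  (forall i j, i < L -> j < L -> x i = x j -> i = j) ->
  imem s 3 = h -> imem s 7 = L -> imem s 8 = M -> imem s 9 = F -> imem s 10 = C ->
  (forall j, j < L -> rmem s (h + j) = x j) ->
  (forall i, i <= L -> rmem s (M + i) = ((master x L)`_i)%R) ->
  (forall i, i < L -> rmem s (F + i) = y i) ->
  16 <= h -> 16 <= M -> 16 <= F -> h + L <= C -> M + L < C -> F + L <= C ->
  C + L <= cap ->
  wp solve s (fun t (s' : state R) => [/\ t <= L * (100 * L + 100) + 50,
    (forall j : 'I_L, rmem s' (C + j) = tsol x y j),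
    (forall a : nat, a != 6 -> a != 13 -> imem s' a = imem s a) &
    (forall a : nat, 16 <= a -> (a < C) || (C + L <= a) -> rmem s' a = rmem s a)]).
Proof.
move=> xinj E3 E7 E8 E9 E10 Ex EM EF leh leM leF lehC leMC leFC lec.
rewrite /solve; do 2!step.
pose Inv (j t : nat) (s' : state R) := [/\ t <= j * (100 * L + 100), imem s' 13 = j,
    (forall i : 'I_L, i < j -> rmem s' (C + i) = tsol x y i),
    (forall a : nat, a != 6 -> a != 13 -> imem s' a = imem s a) &
    (forall a : nat, 16 <= a -> (a < C) || (C + L <= a) -> rmem s' a = rmem s a)].
apply: (@wp_while _ _ _ _ L Inv).
- split=> //.
  by move=> a n6 n13; rewrite /=; upds.
- move=> j t s' le [_ e13 _ fi _].
  have e7 : imem s' 7 = L by rewrite fi.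
  by rewrite /=; split; lia.
- move=> j t s' lt [le e13 eC fi fr].
  have e3 : imem s' 3 = h by rewrite fi.
  have e7 : imem s' 7 = L by rewrite fi.
  have e8 : imem s' 8 = M by rewrite fi.
  have e9 : imem s' 9 = F by rewrite fi.
  have e10 : imem s' 10 = C by rewrite fi.
  pose c := comaster x (Ordinal lt).
  do 11!step.
  (* Cell 2 starts correctly at 0, since coefficient [L] of [c] lies beyond its degree; for [l = L]
     the two sums are complete. *)
  pose Inv2 (l t : nat) (s2 : state R) := [/\ t <= 70 * l,
    [/\ imem s2 6 = L - l, rmem s2 1 = x j & rmem s2 2 = (c`_(L - l))%R],
    rmem s2 3 = (\sum_(L - l <= i < L) c`_i * x j ^+ (i - (L - l)))%R /\
    rmem s2 4 = (\sum_(L - l <= i < L) c`_i * y i)%R,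
    (forall a : nat, a != 6 -> imem s2 a = imem s' a) &
    (forall a : nat, 16 <= a -> rmem s2 a = rmem s' a)].
  apply: (@wp_while _ _ _ _ L Inv2).
  + split=> //=.
    * upds; split; [lia| |].
        by rewrite e3 e13 fr ?Ex //; lia.
      by rewrite subn0 nth_default ?size_comaster.
    * by upds; rewrite subn0 !big_geq.
    * by move=> a n6; upds.
    * by move=> a lea; upds.
  + by move=> l t2 s2 lel [_ [e6 _ _] _ _ _]; rewrite /=; split; lia.
  + move=> l t2 s2 ltl [le2 [f6 f1 f2] [f3 f4] fi2 fr2].
    have f8 : imem s2 8 = M by rewrite fi2.
    have f9 : imem s2 9 = F by rewrite fi2.
    have LE : L - l = (L - l.+1).+1 by lia.
    (* Cell 6 is not yet decremented: coefficient [L - l] of the master polynomial yields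
       coefficient [L - l.+1] of the quotient. *)
    have cE : (rmem s2 2 * rmem s2 1 + rmem s2 (imem s2 8 + imem s2 6) =
      c`_(L - l.+1))%R.
      rewrite f1 f2 f8 f6 fr2 ?fr ?EM; try lia.
      by rewrite /c [in RHS]comasterSr -LE addrC [(_ * x j)%R]mulrC.
    do 7!step; split; rewrite /=.
    * by lia.
    * by upds; split; [lia| |].
    * upds; rewrite cE f1 f3 f4 !(@big_ltn _ _ _ (L - l.+1) L); try lia;
        rewrite -!LE subnn expr0 mulr1.
      split.
        rewrite addrC mulr_suml; congr +%R.
        apply: eq_big_nat => i /andP[lei _]; rewrite -mulrA -exprSr;
          congr (_ * _ ^+ _)%R; lia.
      have -> : imem s2 9 + (imem s2 6 - 1) = F + (L - l.+1) by lia.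
      by rewrite addrC fr2 ?fr ?EF //; lia.
    * by move=> a n6; upds; rewrite fi2.
    * by move=> a lea; upds; rewrite fr2.
  + move=> t2 s2 [le2 [f6 f1 f2] [f3 f4] fi2 fr2].
    have f10 : imem s2 10 = C by rewrite fi2.
    have f13 : imem s2 13 = j by rewrite fi2.
    rewrite subnn big_mkord in f3; rewrite subnn big_mkord in f4.
    have f3E : rmem s2 3 = (c.[x j])%R.
      rewrite f3 (horner_coef_wide _ (size_comaster _ _)).
      by apply: eq_bigr => i _; rewrite subn0.
    (* The divisor is nonzero because the [x] are distinct, which the automatic side-condition check
       cannot see. *)
    step; apply: wp_rset.
      rewrite /= f3E (comaster_neq0 xinj (Ordinal lt)); lia.
    step; split; rewrite /=.
    * by lia.
    * by upds; lia.
    * move=> i; rewrite ltnS leq_eqVlt => /orP[/eqP Ei|lti]; upds.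
        have -> : i = Ordinal lt by apply: val_inj.
        by rewrite f3E f4.
      by rewrite fr2 ?eC //; lia.
    * by move=> a n6 n13; upds; rewrite fi2 // fi.
    * by move=> a lea na; upds; rewrite fr2 // fr.
- move=> t s' [le e13 eC fi fr]; split=> //=; first lia.
  by move=> j; apply: eC.
Qed.

End LinearSystem.

(** * The complete program and the theorem *)

Section Main.
Variables (R : realType) (m n : nat) (f : 'rV[R]_m -> R).
Hypothesis m_gt0 : 0 < m.
(** The queue ends by [17 + m + m * N m n]; three blocks take [3 * N m n + 1] more cells and the
    nodes [m * N m n]. As [m * N m n] is positive, the factor 32 suffices. *)
Let cap := 32 * (m * N m n).

Let y (i : nat) : R := f (\row_(k < m) base R n k ^+ i)%R.

Let leq_mN : m <= m * N m n.
Proof. by rewrite leq_pmulr // N_gt0. Qed.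

Let leq_Nm : N m n <= m * N m n.
Proof. by rewrite leq_pmull. Qed.

Lemma wp_interpolation_gt0 : 0 < n ->
  wp f cap interpolation_program (init R m n) (fun t (s : state R) =>
    [/\ t <= 50 * 50 * N m n ^ 2, output_fits m n cap s,
        (forall i k, output_nodes m n s i k = base R n k ^+ i)%R &
        (forall j : 'I_(N m n), rmem s (imem s 1 + j) = tsol (kappa R m n) y j)]).
Proof.
move=> n_gt0.
have cap16 : 16 <= cap by rewrite /cap; lia.
have leN := N_gt0 m n.
(* Positivity of [n] enters here; it makes writing all coordinates fit into quadratic time. *)
have ltmN : m <= N m n.
  by apply: leq_trans (ltnW (ltn_mul_N m n)); rewrite leq_pmulr.
have lemN : m * N m n <= N m n ^ 2 by rewrite expnS expn1 leq_mul2r ltmN orbT.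
rewrite /interpolation_program; step; have ->
  : (ival (init R m n) (ireg 1) <= ival (init R m n) (ILit 0)) = false.
  by rewrite /=; lia.
step; apply: wp_conseq; first by apply: wp_queue => //; rewrite /cap; lia.
move=> t1 s1 [h [[t1le e0 e3 e4] [leh lehN] eb ek ez]].
set M := h + N m n in e4 ez; set F := M + N m n + 1; set C := F + N m n.
set P := C + N m n.
have [EM EF EC EP] : [/\ M = h + N m n, F = M + N m n + 1,
  C = F + N m n & P = C + N m n] by [].
have lec : P + N m n * m <= cap by rewrite EP EC EF EM [N m n * m]mulnC /cap; lia.
(* The block addresses become opaque, known only through linear equations. *)
clearbody M F C P.
do 11!step.
apply: wp_conseq.
  apply: (@wp_expand_master _ _ _ _ cap16 _ h M (N m n) (kappa R m n)) => //=; upds;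
    try lia.
  - by move=> i _; apply: ez; lia.
move=> t2 s2 [t2le eM fi2 fr2].
step; apply: wp_conseq.
  apply: (@wp_sample _ _ _ _ cap16 _ (N m n) F P (base R n)) => //=; try lia.
  - by rewrite fi2 //=; upds.
  - by rewrite fi2 //=; upds; lia.
  - by rewrite fi2 //=; upds; lia.
  - by rewrite fi2 //=; upds; lia.
  - by move=> k ltk; rewrite fr2 /=; try lia; apply: eb.
move=> t3 s3 [t3le eP eF fi3 fr3].
step; apply: wp_conseq.
  apply: (@wp_solve _ _ _ _ cap16 _ h (N m n) M F C (kappa R m n) y) => //; try lia.
  - exact: kappa_inj.
  - by rewrite fi3 ?fi2 //=; upds.
  - by rewrite fi3 ?fi2 //=; upds; lia.
  - by rewrite fi3 ?fi2 //=; upds; lia.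
  - by rewrite fi3 ?fi2 //=; upds; lia.
  - by rewrite fi3 ?fi2 //=; upds; lia.
  - by move=> j ltj; rewrite fr3 ?fr2 /=; try lia; apply: ek.
  - by move=> i lei; rewrite fr3 ?eM //; lia.
move=> t4 s4 [t4le eC fi4 fr4].
have f10 : imem s4 10 = C by rewrite fi4 // fi3 // fi2 //=; upds; lia.
have f11 : imem s4 11 = P by rewrite fi4 // fi3 // fi2 //=; upds; lia.
do 3!step; split.
- have : N m n <= N m n * N m n by rewrite leq_pmulr.
  by rewrite -mulnn in lemN *; rewrite /=; lia.
- by rewrite /output_fits /=; upds; lia.
- move=> i k; rewrite mxE /=; upds.
  rewrite f11 fr4 ?eP //; lia.
- by move=> j; rewrite /=; upds; rewrite f10.
Qed.

Lemma wp_interpolation_eq0 : n = 0 ->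
  wp f cap interpolation_program (init R m n) (fun t (s : state R) =>
    [/\ t <= 50 * 50 * N m n ^ 2, output_fits m n cap s,
        (forall i k, output_nodes m n s i k = 0)%R &
        (forall j : 'I_(N m n), rmem s (imem s 1 + j) = f 0%R)]).
Proof.
move=> n0; have N1 : N m n = 1 by rewrite n0 /N addn0 binn.
have cap16 : 16 <= cap by rewrite /cap; lia.
have lec : 1 + m <= cap by rewrite /cap N1; lia.
rewrite /interpolation_program; step; have ->
  : ival (init R m n) (ireg 1) <= ival (init R m n) (ILit 0).
  by rewrite /= n0.
do 5!step; split.
- by rewrite N1.
- by rewrite /output_fits N1 /=; upds; lia.
- by move=> i k; rewrite mxE /=; upds.
- move=> j; have -> : j = 0 :> nat by have := ltn_ord j; lia.
  rewrite /=; upds; congr f; apply/rowP => k; by rewrite !mxE.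
Qed.

End Main.

Lemma output_polyE (R : realType) m n (s : state R) :
  output_poly m n s = poly_of m n (fun j => rmem s (imem s 1 + j)).
Proof. by []. Qed.

Theorem theorem2p1 (R : realType) :
  exists (prog : cmd) (c1 c2 : nat),
  forall (m n : nat) (f : 'rV[R]_m -> R), (1 <= m)%N ->
  let cap := (c2 * (m * N m n))%N in
  exists (t : nat) (s : state R),
    [/\ exec f cap prog (init R m n) t s,
        (t <= c1 * N m n ^ 2)%N
      & output_fits m n cap s] /\
    (let P := output_nodes m n s in
     let Q := output_poly m n s in
     [/\ generic P,
         (msize Q <= n.+1)%N,
         interpolates f P Q
       & forall Q' : {mpoly R[m]},
           (msize Q' <= n.+1)%N -> interpolates f P Q' -> Q' = Q]).
Proof.
exists interpolation_program, (50 * 50), 32 => m n f m_gt0 cap.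
suff [t [s [e [le fits gP iPQ]]]] : wp f cap interpolation_program (init R m n)
    (fun t s => [/\ t <= 50 * 50 * N m n ^ 2, output_fits m n cap s,
       generic (output_nodes m n s) &
       interpolates f (output_nodes m n s) (output_poly m n s)]).
  have szQ : msize (output_poly m n s) <= n.+1.
    by rewrite output_polyE msize_poly_of.
  exists t, s; split=> //=; split=> // Q' szQ'.
  exact: (generic_uniq gP szQ szQ' iPQ).
have [n0|n_gt0] := posnP n.
  apply: wp_conseq (wp_interpolation_eq0 f m_gt0 n0) _ => t s [le fits nodes coefs].
  have N1 : N m n = 1 by rewrite n0 /N addn0 binn.
  (* The only monomial is 1, so the matrix is the identity of size 1. *)
  have V1 : vandermonde (output_nodes m n s) = 1%:M%R.
    apply/matrixP => i j; rewrite mxE.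
    have -> : i = j by apply: ord_inj; have := ltn_ord i; have := ltn_ord j; lia.
    rewrite mxE eqxx big1 // => k _.
    have /eqP : mdeg (monom m n j) = 0 by have := mdeg_monom j; lia.
    rewrite mdeg_eq0 => /eqP ->.
    by rewrite mnmE expr0.
  split=> //; first by rewrite /generic V1 unitmx1.
  move=> i; rewrite output_polyE poly_of_eval V1 (bigD1 i) //= big1 ?addr0 => [|j ji].
    rewrite mxE eqxx mul1r coefs; congr f; apply/rowP => k;
      by rewrite [LHS]mxE [RHS]mxE nodes.
  by rewrite mxE eq_sym (negbTE ji) mul0r.
apply: wp_conseq (wp_interpolation_gt0 f m_gt0 n_gt0) _ => t s [le fits nodes coefs].
have VE := vandermonde_pow nodes.
have kinj := @kappa_inj R m n.
split=> //; first by rewrite /generic VE tvander_unit.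
move=> i; rewrite output_polyE poly_of_eval VE.
under eq_bigr => j _ do rewrite mxE coefs.
(* The condition at node [i] is equation [i] of the transposed univariate system. *)
rewrite (tsolP _ kinj); congr f; apply/rowP => k.
by rewrite [LHS]mxE [RHS]mxE nodes.
Qed.
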